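(* Let $n\ge1$. Let $L_n$ be the set of closed lattice walks of length $2n$ from $(0,0)$ to $(0,0)$ with steps $E=(1,0)$, $W=(-1,0)$, $N=(0,1)$, $S=(0,-1)$, all of whose points $(x,y)$ satisfy $x\ge y$, and in which every step $N$ is immediately followed by a (possibly empty) run of consecutive $W$ steps and then one step $S$. Let $P_n$ be the set of lattice paths from $(0,0)$ to $(2n,n)$ with steps $E=(1,0)$ and $N=(0,1)$ all of whose points $(x,y)$ satisfy $y\le x/2$. Let $\tau$ be the map on step words that replaces each step of a walk in $L_n$ (read from left to right) according to $E\mapsto EE$, $W\mapsto N$, $N\mapsto EN$, $S\mapsto E$. Then $\tau$ is a bijection from $L_n$ onto $P_n$, and $$|L_n|=|P_n|=|\mathcal{M}_n(12312)|=\frac{1}{2n+1}\binom{3n}{n},$$ where $\mathcal{M}_n(12312)$ is the set of matchings on $[2n]$ avoiding the pattern $12312$.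
   Context: A matching on $[2n]$ is a partition of $[2n]$ into $n$ blocks of size two (edges). The canonical sequential form of a matching with $n$ edges is the word of length $2n$ obtained by labeling edges $1,\dots,n$ in increasing order of their smaller elements and writing at each position the label of the edge containing it. Words $a_1\cdots a_k$, $b_1\cdots b_k$ are order-isomorphic if $a_i<a_j\iff b_i<b_j$ for all $i,j$. A matching contains a pattern $\tau$ if its canonical sequential form has a subsequence order-isomorphic to $\tau$, and avoids $\tau$ otherwise. *)

(* Defs.v *)
From HB Require Import structures.
From mathcomp Require Import all_boot all_order all_algebra.
From mathcomp Require Import all_classical.

Set Implicit Arguments.
Unset Strict Implicit.
Unset Printing Implicit Defensive.

Import Order.TTheory GRing.Theory Num.Theory.

Local Open Scope classical_set_scope.
Local Open Scope ring_scope.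

Inductive step : Type := East | West | North | South.

Definition step_code (s : step) : bool * bool :=
  match s with
  | East => (false, false) | West => (false, true)
  | North => (true, false) | South => (true, true)
  end.

Definition step_decode (b : bool * bool) : step :=
  match b with
  | (false, false) => East | (false, true) => West
  | (true, false) => North | (true, true) => South
  end.

Lemma step_codeK : cancel step_code step_decode.
Proof. by case. Qed.

HB.instance Definition _ := Finite.copy step (can_type step_codeK).

Definition disp (s : step) : int * int :=
  match s with
  | East => (1, 0) | West => (-1, 0) | North => (0, 1) | South => (0, -1)
  end.

(* The points visited by the walk w are endpoint (take k w) for k : nat. *)
Definition endpoint (w : seq step) : int * int := \sum_(s <- w) disp s.

Definition north_followed (w : seq step) : Prop :=
  forall u v : seq step, w = u ++ North :: v ->
  exists (k : nat) (v' : seq step), v = nseq k West ++ South :: v'.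

Definition walks (n : nat) : set (seq step) :=
  [set w | [/\ size w = (2 * n)%N,
               endpoint w = (0, 0),
               forall k : nat,
                 (endpoint (take k w)).1 >= (endpoint (take k w)).2
             & north_followed w]].

Definition paths (n : nat) : set (seq step) :=
  [set w | [/\ {subset w <= [:: East; North]},
               endpoint w = ((2 * n)%:Z, n%:Z)
             & forall k : nat,
                 (endpoint (take k w)).2%:Q <=
                 (endpoint (take k w)).1%:Q / 2%:Q]].

Definition tau_step (s : step) : seq step :=
  match s with
  | East => [:: East; East]
  | West => [:: North]
  | North => [:: East; North]
  | South => [:: East]
  end.

Definition tau (w : seq step) : seq step := flatten [seq tau_step s | s <- w].

(* The ground set [N] is represented by 'I_N, i.e. shifted to {0, ..., N-1}. *)
Definition is_matching (N : nat) (m : {set {set 'I_N}}) : Prop :=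
  finset.partition m [set: 'I_N]%SET /\ (forall b, b \in m -> #|b| = 2%N).

(* The default value N of the minimum is larger than every element of 'I_N,
   so it is only attained when b is empty. *)
Definition edge_min (N : nat) (b : {set 'I_N}) : nat :=
  \big[minn/N]_(i in b) (i : nat).

(* Labels start at 1: the edge b is itself counted. *)
Definition edge_label (N : nat) (m : {set {set 'I_N}}) (b : {set 'I_N}) : nat :=
  #|[set c in m | (edge_min c <= edge_min b)%N]%SET|.

Definition canonical_form (N : nat) (m : {set {set 'I_N}}) : seq nat :=
  [seq edge_label m (finset.pblock m i) | i <- enum 'I_N].

Definition order_iso (a b : seq nat) : Prop :=
  size a = size b /\
  forall i j : nat, (i < size a)%N -> (j < size a)%N ->
    (nth 0 a i < nth 0 a j)%N <-> (nth 0 b i < nth 0 b j)%N.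

Definition contains (N : nat) (m : {set {set 'I_N}}) (p : seq nat) : Prop :=
  exists2 s : seq nat, subseq s (canonical_form m) & order_iso s p.

Definition avoiding_matchings (n : nat) (p : seq nat) :
    set {set {set 'I_(2 * n)}} :=
  [set m | is_matching m /\ ~ contains m p].
Arguments avoiding_matchings : clear implicits.

(* Main.v *)
(** A walk in [walks n] has as many [South] as [North] steps, so it is a product
    of [East], [West] and blocks [North West^k South] at height [y = 1]; the
    statistic [x - 2y] of its image under [tau] is then [2x] outside the blocks
    and [2x - 1] inside them. Parity therefore lets one parse a path back.

    Paths with [m] steps, [b] of them [North], are counted by
    ['C(m, b) - 2 'C(m, b - 1)], which satisfies the recurrence on the last step
    and vanishes on the boundary [3 b = m + 1].

    A matching avoids 12312 iff, whenever edges [a < b] cross, no edge opens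
    between the opener of [b] and the closer of [a]. Scanning from left to right
    with the stack of open edges, a closer thus closes the top of the stack, or
    the second edge provided that the top was the last edge opened. This encodes
    the matching by a word in three letters, and such words translate into
    paths: with [s] open edges the path is at [x - 2y = 2s - 1] if the top is the
    last edge opened and at [2s] otherwise. *)

Require Import Defs.
From mathcomp Require Import all_boot all_order all_algebra.
From mathcomp Require Import all_classical.
From mathcomp Require Import zify.

Set Implicit Arguments.
Unset Strict Implicit.
Unset Printing Implicit Defensive.

Import Order.TTheory GRing.Theory Num.Theory.

Local Open Scope classical_set_scope.
Local Open Scope ring_scope.

(** * Paths *)

Definition num (s : step) (w : seq step) : nat := count_mem s w.
Arguments num : simpl never.

Lemma num_nil (s : step) : num s [::] = 0%N.
Proof. by []. Qed.

Lemma num_cons (s t : step) (w : seq step) :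
  num s (t :: w) = ((t == s) + num s w)%N.
Proof. by []. Qed.

Lemma num_rcons (s t : step) (w : seq step) :
  num s (rcons w t) = ((t == s) + num s w)%N.
Proof. by rewrite /num -cats1 count_cat /= addn0 addnC. Qed.

Lemma endpoint_count (w : seq step) :
  endpoint w = ((num East w)%:Z - (num West w)%:Z,
                (num North w)%:Z - (num South w)%:Z).
Proof.
elim: w => [|s w IH]; first by rewrite /endpoint big_nil.
rewrite /endpoint big_cons -/(endpoint w) IH !num_cons.
by case: s; congr pair => /=; lia.
Qed.

(* [h] stands for [x - 2y] at the starting point. *)
Fixpoint path_from (h : nat) (w : seq step) : bool :=
  match w with
  | [::] => h == 0
  | East :: w' => path_from h.+1 w'
  | North :: w' => (1 < h)%N && path_from h.-2 w'
  | _ => false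
  end.

Definition east_north (w : seq step) : bool :=
  all (mem [:: East; North]) w.

(** The condition [y <= x / 2] at every point, cleared of its denominator, for a start at
    [x - 2y = h]. *)
Definition ballot_prefix (h : nat) (w : seq step) : Prop :=
  forall k, (2 * num North (take k w) <= h + num East (take k w))%N.

Lemma path_fromP (h : nat) (w : seq step) :
  path_from h w <->
  [/\ east_north w, (h + num East w = 2 * num North w)%N
    & ballot_prefix h w].
Proof.
elim: w h => [|s w IH] h /=.
  split=> [/eqP-> //|[_ /eqP]]; last by rewrite addn0.
have cons_prefix P : (forall k, P (take k (s :: w))) <->
    P [::] /\ forall k, P (s :: take k w).
  split=> [H|[H0 H] [|k]] //.
  by split=> [|k]; [apply: (H 0%N)|apply: (H k.+1)].
  exact: H.
rewrite /ballot_prefix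
  (propext (cons_prefix (fun v => 2 * num North v <= h + num East v)%N)).
have nums v t : num t (s :: v) = ((s == t) + num t v)%N by [].
rewrite !nums; under [in X in _ <-> X]eq_forall do rewrite !nums.
clear cons_prefix nums; case: s => /=; rewrite /east_north /=.
- rewrite IH; split=> [[H1 H2 H3]|[H1 H2 [_ H3]]]; split=> //; try lia.
    by split=> // k; have := H3 k; lia.
  by move=> k; have := H3 k; lia.
- by split=> // -[].
- split=> [/andP[h1 /IH[H1 H2 H3]]|[H1 H2 [_ H3]]].
    split=> //; try lia.
    by split=> // k; have := H3 k; lia.
  have h1 : (1 < h)%N by have := H3 0%N; rewrite take0 !num_nil; lia.
  rewrite h1; apply/IH; split=> //; try lia.
  by move=> k; have := H3 k; lia.
- by split=> // -[].
Qed.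

Lemma count_east_north (w : seq step) : east_north w ->
  [/\ num West w = 0%N, num South w = 0%N
    & (num East w + num North w = size w)%N].
Proof.
elim: w => //= s w IH /andP[sE /IH[H1 H2 H3]].
by rewrite !num_cons; split; case: s sE => //= _; lia.
Qed.

Lemma paths_nat (n : nat) (w : seq step) :
  paths n w <->
  [/\ east_north w, (num East w = 2 * n)%N, (num North w = n)%N
    & ballot_prefix 0 w].
Proof.
have half (x y : nat) : (y%:Z%:Q <= x%:Z%:Q / 2%:Q) = (2 * y <= x)%N.
  rewrite ler_pdivlMr // -intrM ler_int; lia.
have prefix k : east_north w ->
    ((endpoint (take k w)).2%:Q <= (endpoint (take k w)).1%:Q / 2%:Q) =
    (2 * num North (take k w) <= num East (take k w))%N.
  move=> wEN; have /count_east_north[W0 S0 _] : east_north (take k w).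
    by apply/allP => s /mem_take; move: s; apply/allP.
  by rewrite endpoint_count W0 S0 !subr0 half.
split.
- case=> /allP wEN; rewrite endpoint_count.
  have [-> -> _] := count_east_north wEN.
  rewrite !subr0 => -[cE cN] H; split=> // k.
  by rewrite add0n -prefix.
- case=> wEN cE cN H; split; first exact/allP.
    rewrite endpoint_count; have [-> -> _] := count_east_north wEN.
    by rewrite !subr0 cE cN.
  by move=> k; rewrite prefix //; have := H k.
Qed.

Lemma paths_path_from (n : nat) (w : seq step) :
  paths n w <-> path_from 0 w /\ num North w = n.
Proof.
rewrite paths_nat path_fromP; split=> [[H1 H2 H3 H4]|[[H1 H2 H3] H4]].
  by split=> //; split=> //; lia.
by split=> //; lia.
Qed.

(** * Enumeration and number of the paths *)

Fixpoint ballot_words (m b : nat) : seq (seq step) :=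
  if m is m'.+1 then
    if (3 * b <= m)%N then
      map (rcons^~ East) (ballot_words m' b) ++
      (if b is b'.+1 then map (rcons^~ North) (ballot_words m' b') else [::])
    else [::]
  else if b == 0%N then [:: [::]] else [::].

Lemma ballot_prefix_rcons (w : seq step) (s : step) :
  ballot_prefix 0 (rcons w s) <->
  ballot_prefix 0 w /\
  (2 * num North (rcons w s) <= num East (rcons w s))%N.
Proof.
split=> [H|[H1 H2] k].
  split=> [k|]; last by have := H (size w).+1; rewrite take_oversize ?size_rcons.
  have [kw|/ltnW kw] := leqP k (size w).
    by have := H k; rewrite -cats1 takel_cat.
  by have := H (size w); rewrite -cats1 takel_cat // !take_oversize.
have [kw|kw] := leqP k (size w).
  by rewrite -cats1 takel_cat //; apply: H1.
by rewrite take_oversize ?size_rcons.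
Qed.

(** The guard [3 * b <= m] is the ballot condition at the end point, where [m - b] letters are
    [East]; the recursive calls test the shorter prefixes. *)
Lemma mem_ballot_words (m b : nat) (w : seq step) :
  w \in ballot_words m b <->
  [/\ east_north w, size w = m, num North w = b & ballot_prefix 0 w].
Proof.
elim: m b w => [|m IH] b w /=.
  case: eqP => [->|b0]; rewrite ?inE.
    split=> [/eqP-> //|[_ /size0nil -> //]].
  by split=> // -[_ /size0nil -> /= /esym].
case: leqP => [bm|bm]; last first.
  split=> // -[/count_east_north[_ _ H1] H2 H3 H4].
  by have := H4 m.+1; rewrite take_oversize ?H2 // add0n; lia.
rewrite mem_cat; split.
- case/orP=> [/mapP[v /IH[H1 H2 H3 H4] ->]|].
    have [_ _ cv] := count_east_north H1.
    have -> : east_north (rcons v East) by rewrite /east_north all_rcons.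
    rewrite (propext (ballot_prefix_rcons _ _)) size_rcons !num_rcons /=.
    by split=> //; try split=> //; lia.
  case: b bm => // b bm /mapP[v /IH[H1 H2 H3 H4] ->].
  have [_ _ cv] := count_east_north H1.
  have -> : east_north (rcons v North) by rewrite /east_north all_rcons.
  rewrite (propext (ballot_prefix_rcons _ _)) size_rcons !num_rcons /=.
  by split=> //; try split=> //; lia.
- case/lastP: w => [|w s] [] //; rewrite /east_north all_rcons => /andP[sE wE].
  rewrite size_rcons (propext (ballot_prefix_rcons _ _)) !num_rcons => -[sz] cb [pw _].
  case: s sE cb => // _ /= cb; apply/orP; [left|right].
    by apply: map_f; apply/IH; split=> //; lia.
  case: b bm cb => [|b] bm cb; first by lia.
  by apply: map_f; apply/IH; split=> //; lia.
Qed.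

Lemma uniq_ballot_words (m b : nat) : uniq (ballot_words m b).
Proof.
elim: m b => [|m IH] b /=; first by case: eqP.
have inj t : injective (fun w : seq step => rcons w t).
  by move=> u v /rcons_inj[].
case: leqP => // _; rewrite cat_uniq (map_inj_uniq (inj East)) IH /=.
case: b => //= b; rewrite (map_inj_uniq (inj North)) IH andbT.
by apply/hasPn => _ /mapP[v _ ->]; apply/mapP => -[u _ /rcons_inj[]].
Qed.

(** The range includes the boundary [3 * b = m.+1], where the list is empty, because the recurrence
    for words of length [m.+1] calls that value. *)
Lemma size_ballot_words (m b : nat) : (3 * b <= m.+1)%N ->
  (size (ballot_words m b) + (if b is b'.+1 then 2 * 'C(m, b') else 0) = 'C(m, b))%N.
Proof.
elim: m b => [|m IH] b bm /=; first by case: b bm => [|[]] //=.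
case: leqP => [{}bm|bm'].
  case: b bm => [|b] bm; first by rewrite cats0 size_map; have := IH 0%N isT; rewrite !bin0.
  have := IH b.+1 bm; have := IH b; rewrite size_cat !size_map.
  case: b bm => [|b] bm; rewrite ?binS ?bin0; first by lia.
  by move=> /(_ ltac:(lia)); lia.
(* On the boundary the claim is ['C(3b - 1, b) = 2 'C(3b - 1, b - 1)], which is [mul_bin_left] with
   a factor [b] cancelled. *)
have -> : m.+1 = (3 * b).-1 by lia.
case: b bm bm' => [|b] bm bm'; first by lia.
rewrite add0n; have := mul_bin_left (3 * b.+1).-1 b.
have -> : ((3 * b.+1).-1 - b = 2 * b.+1)%N by lia.
nia.
Qed.

(** * Cardinality of the set of paths *)

Lemma set_bij_card_eq (T U : Type) (A : set T) (B : set U) (f : T -> U) :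
  set_bij A B f -> (A #= B)%card.
Proof. by move=> fAB; exact: (pcard_eq fAB). Qed.

Lemma card_eq_seq (T : eqType) (s : seq T) : uniq s ->
  ([set x | x \in s] #= `I_(size s))%card.
Proof.
move=> us; apply: (@set_bij_card_eq _ _ _ _ (index^~ s)); split.
- by move=> x /= xs; rewrite index_mem.
- move=> x y; rewrite !inE /= => xs ys; exact: index_inj.
- case: s us => [|x0 s] us i // si.
  by exists (nth x0 (x0 :: s) i); [apply: mem_nth|apply: index_uniq].
Qed.

Lemma paths_ballot_words (n : nat) :
  paths n = [set w | w \in ballot_words (3 * n) n].
Proof.
apply/seteqP; split=> w /=.
  case/paths_nat=> wE cE cN wb; apply/mem_ballot_words; split=> //.
  by have [_ _ <-] := count_east_north wE; lia.
case/mem_ballot_words=> wE sw cN wb; apply/paths_nat; split=> //.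
by have [_ _] := count_east_north wE; lia.
Qed.

(** For [n > 0], since [n 'C(3n, n) = (2n + 1) 'C(3n, n - 1)], subtracting [2 'C(3n, n - 1)] from
    ['C(3n, n)] leaves its fraction [1 / (2n + 1)]. *)
Lemma size_ballot_words_fuss_catalan (n : nat) :
  ((2 * n + 1) * size (ballot_words (3 * n) n) = 'C(3 * n, n))%N.
Proof.
have := @size_ballot_words (3 * n) n (leqnSn _).
case: n => [|n]; first by rewrite !bin0.
have := mul_bin_left (3 * n.+1) n.
have -> : (3 * n.+1 - n = 2 * n.+1 + 1)%N by lia.
nia.
Qed.

(** * Walks and the map tau *)

(* [f] records whether the walk is between a [North] and its [South], in which
   case it is at height 1 and otherwise at height 0. *)
Fixpoint walk_from (x : nat) (f : bool) (w : seq step) : bool :=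
  match w with
  | [::] => (x == 0%N) && ~~ f
  | East :: w' => ~~ f && walk_from x.+1 f w'
  | West :: w' => (f < x)%N && walk_from x.-1 f w'
  | North :: w' => [&& ~~ f, (0 < x)%N & walk_from x true w']
  | South :: w' => f && walk_from x false w'
  end.

(** The flag marks a [North] waiting for its [South]. A [South] with no [North] waiting is accepted,
    as [north_followed] does not forbid it. *)
Fixpoint north_closed (f : bool) (w : seq step) : bool :=
  match w with
  | [::] => ~~ f
  | East :: w' => ~~ f && north_closed f w'
  | West :: w' => north_closed f w'
  | North :: w' => ~~ f && north_closed true w'
  | South :: w' => north_closed false w'
  end.

Lemma north_closed_trueP (w : seq step) :
  north_closed true w <->
  exists k v, w = nseq k West ++ South :: v /\ north_closed false v.
Proof.
split.
- elim: w => [|[] w IH] //= cw.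
    by have [k [v [-> ?]]] := IH cw; exists k.+1, v.
  by exists 0%N, w.
- by case=> k [v [-> cv]]; elim: k.
Qed.

Lemma north_followed_cons (s : step) (w : seq step) :
  north_followed (s :: w) -> north_followed w.
Proof. by move=> H u v e; apply: (H (s :: u) v); rewrite e. Qed.

Lemma north_followed_catr (u w : seq step) :
  north_followed (u ++ w) -> north_followed w.
Proof. by elim: u => //= s u IH /north_followed_cons. Qed.

Lemma north_followedP (w : seq step) :
  north_followed w <-> north_closed false w.
Proof.
split.
(* Induction on the length, since a whole block [North West^k South] is consumed at once. *)
- have [m] := ubnP (size w); elim: m w => // m IH [|s w] //= sw Hw.
  have Hw' := north_followed_cons Hw.
  case: s Hw sw => Hw sw /=; try exact: IH.
  have [k [v e]] := Hw [::] w erefl; apply/north_closed_trueP.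
  exists k, v; split=> //; apply: IH.
    by move: sw; rewrite e size_cat /= size_nseq; lia.
  by move: Hw'; rewrite e => /north_followed_catr/north_followed_cons.
- move=> cw u v e; rewrite {w}e in cw.
  suff /north_closed_trueP[k [v' [-> _]]] : north_closed true v by exists k, v'.
  elim: u false cw => [|s u IH] f /=; first by case/andP.
  by case: s => [/andP[_ /IH]|/IH|/andP[_ /IH]|/IH].
Qed.

(** Every [North] owns the [South] ending its block. Equal totals thus leave no [South] outside a
    block, which is how [walk_fromP] excludes a descent below height 0. *)
Lemma north_closed_num (f : bool) (w : seq step) :
  north_closed f w -> (num North w + f <= num South w)%N.
Proof.
elim: w f => [|s w IH] f; first by case: f.
by rewrite !num_cons; case: s => /= [/andP[_ /IH]|/IH|/andP[+ /IH]|/IH] /=; case: f; lia.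
Qed.

(** The condition [x >= y] along a walk started at [(x, f)], with negative terms moved across. *)
Definition diagonal_prefix (x : nat) (f : bool) (w : seq step) : Prop :=
  forall k, (f + num North (take k w) + num West (take k w) <=
             x + num East (take k w) + num South (take k w))%N.

Lemma diagonal_prefix_cons (x : nat) (f : bool) (s : step) (w : seq step) :
  diagonal_prefix x f (s :: w) <->
  (f <= x)%N /\
  forall k, (f + ((s == North) + num North (take k w))
               + ((s == West) + num West (take k w)) <=
             x + ((s == East) + num East (take k w))
               + ((s == South) + num South (take k w)))%N.
Proof.
split=> [H|[fx H] [|k]].
- split; first by have := H 0%N; rewrite !num_nil !addn0.
  by move=> k; have := H k.+1; rewrite /= !num_cons.
- by rewrite !num_nil !addn0.
- by rewrite /= !num_cons; apply: H.
Qed.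

(** The height is 1 inside blocks and 0 outside, so [(x, f)] is the current point, and [x >= y] can
    fail only after a [West] or a [North]. *)
Lemma walk_fromP (x : nat) (f : bool) (w : seq step) : (f <= x)%N ->
  walk_from x f w <->
  [/\ north_closed f w, (f + num North w = num South w)%N,
      (x + num East w = num West w)%N & diagonal_prefix x f w].
Proof.
elim: w x f => [|s w IH] x f fx.
  split=> /=.
    case/andP=> /eqP-> /negbTE->; split=> //.
  by case=> /negbTE -> _ /eqP; rewrite addn0 => ->.
rewrite (propext (diagonal_prefix_cons _ _ _ _)) !num_cons.
case: s => /=.
- split=> [/andP[f0 /IH[|H1 H2 H3 H4]]|]; first by lia.
    split=> //; rewrite ?f0 //; try lia.
    by split=> // k; have := H4 k; lia.
  case=> /andP[f0 H1] H2 H3 [_ H4]; rewrite f0; apply/IH; first by lia.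
  split=> //; try lia.
  by move=> k; have := H4 k; lia.
- split=> [/andP[f0 /IH[|H1 H2 H3 H4]]|]; first by lia.
    split=> //; try lia.
    by split=> // k; have := H4 k; lia.
  case=> H1 H2 H3 [_ H4].
  have f0 : (f < x)%N by have := H4 0%N; rewrite take0 !num_nil; lia.
  rewrite f0; apply/IH; first by lia.
  split=> //; try lia.
  by move=> k; have := H4 k; lia.
- split=> [/and3P[f0 x0 /IH[|H1 H2 H3 H4]]|]; first by lia.
    split=> //; rewrite ?f0 //; try lia.
    by split=> // k; have := H4 k; lia.
  case=> /andP[f0 H1] H2 H3 [_ H4].
  have x0 : (0 < x)%N by have := H4 0%N; rewrite take0 !num_nil; lia.
  rewrite f0 x0; apply/IH; first by lia.
  split=> //; try lia.
  by move=> k; have := H4 k; lia.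
- split=> [/andP[f0 /IH[|H1 H2 H3 H4]]|]; first by lia.
    split=> //; try lia.
    by split=> // k; have := H4 k; lia.
  case=> H1 H2 H3 [_ H4].
  have f0 : f by have := north_closed_num H1; lia.
  rewrite f0; apply/IH; first by lia.
  split=> //; try lia.
  by move=> k; have := H4 k; lia.
Qed.

Lemma size_num (w : seq step) :
  size w = (num East w + num West w + (num North w + num South w))%N.
Proof.
elim: w => [|s w IH] //; rewrite !num_cons /= IH.
by case: s => /=; lia.
Qed.

Lemma walks_walk_from (n : nat) (w : seq step) :
  walks n w <-> walk_from 0 false w /\ size w = (2 * n)%N.
Proof.
split.
- case=> sw; rewrite endpoint_count => -[e1 e2] H /north_followedP cw.
  split=> //; apply/walk_fromP => //; split=> //; try lia.
  by move=> k; have := H k; rewrite endpoint_count /=; lia.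
- case=> /walk_fromP[//|H1 H2 H3 H4] sw; split=> //.
  + by rewrite endpoint_count; congr pair; lia.
  + by move=> k; have := H4 k; rewrite endpoint_count /=; lia.
  + exact/north_followedP.
Qed.

(** * The map [tau] and its inverse *)

Lemma tau_cons (s : step) (w : seq step) : tau (s :: w) = tau_step s ++ tau w.
Proof. by []. Qed.

(** The images of [East], [West], [North], [South] change the height of the path by +2, -2, -1, +1,
    exactly as [2x - f] changes on the walk. *)
Lemma path_from_tau (x : nat) (f : bool) (w : seq step) : (f <= x)%N ->
  walk_from x f w -> path_from (x.*2 - f) (tau w).
Proof.
elim: w x f => [|s w IH] x f fx; first by case/andP=> /eqP->.
rewrite tau_cons; case: s => /=.
- by case: f fx => //= fx /IH; rewrite !subn0; apply.
- case/andP=> f0 /IH H; have -> : (1 < x.*2 - f)%N by lia.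
  have -> : (x.*2 - f).-2 = (x.-1.*2 - f)%N by lia.
  by apply: H; lia.
- case: f fx => //= fx /andP[x0 /IH H]; have -> : (1 < (x.*2 - 0).+1)%N by lia.
  have -> : (x.*2 - 0).-1 = (x.*2 - 1)%N by lia.
  by apply: H; lia.
- case: f fx => //= fx /IH; rewrite subn0.
  have -> : (x.*2 - 1).+1 = x.*2 by lia.
  by apply.
Qed.

(** In a closed walk [East] balances [West] and [North] balances [South], so this number is half the
    length of the walk. *)
Lemma num_North_tau (w : seq step) :
  num North (tau w) = (num West w + num North w)%N.
Proof.
elim: w => // s w IH; rewrite tau_cons !num_cons.
by case: s; rewrite /= !num_cons IH /=; lia.
Qed.

(* Reading a path letter by letter, [EvenEast] is the state in which one [East]
   was read at even height, so that the next letter tells [East] from [North]. *)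
Inductive tau_state := Even | EvenEast | Odd.

Fixpoint untau (q : tau_state) (w : seq step) : seq step :=
  match w with
  | [::] => [::]
  | s :: w' =>
    match q, s with
    | Even, North => West :: untau Even w'
    | Even, _ => untau EvenEast w'
    | EvenEast, North => North :: untau Odd w'
    | EvenEast, _ => East :: untau Even w'
    | Odd, North => West :: untau Odd w'
    | Odd, _ => South :: untau Even w'
    end
  end.

Lemma tauK (x : nat) (f : bool) (w : seq step) :
  walk_from x f w -> untau (if f then Odd else Even) (tau w) = w.
Proof.
elim: w x f => [|s w IH] x f //; rewrite tau_cons.
by case: s; case: f => //=; try (case/andP=> _); move/IH => ->.
Qed.

Definition tau_state_height (q : tau_state) (x : nat) : nat :=
  match q with Even => x.*2 | EvenEast => x.*2.+1 | Odd => x.*2.-1 end.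

Definition is_odd_state (q : tau_state) : bool :=
  if q is Odd then true else false.

(** In state [EvenEast] one [East] has been read with nothing written for it yet, so [tau] of the
    output also restores that letter. *)
Lemma untauP (q : tau_state) (x : nat) (w : seq step) :
  (is_odd_state q <= x)%N -> path_from (tau_state_height q x) w ->
  walk_from x (is_odd_state q) (untau q w) /\
  tau (untau q w) = if q is EvenEast then East :: w else w.
Proof.
elim: w q x => [|s w IH] q x qx.
  (* Height 0 is even, so the path can only end in state [Even]. *)
  case: q qx => //= qx /eqP e; last by lia.
  by have -> : x = 0%N by lia.
case: q qx => qx; case: s => //=.
- by move/(IH EvenEast x qx).
- case/andP=> x1 H; have [||H1 H2] := IH Even x.-1; try by [].
    by rewrite /= (_ : x.-1.*2 = x.*2.-2) //; lia.
  by rewrite tau_cons H2 /= H1 andbT; split=> //; lia.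
- move=> H; have [||H1 H2] := IH Even x.+1; try by [].
  by rewrite tau_cons H2 /= H1.
- case/andP=> x1 H; have [||H1 H2] := IH Odd x; rewrite /=; try by [|lia].
  by rewrite tau_cons H2 /= H1 andbT; split=> //; lia.
- move=> H; have [||H1 H2] := IH Even x; try by [].
    by rewrite /= (_ : x.*2 = x.*2.-1.+1) //; move: qx => /=; lia.
  by rewrite tau_cons H2 /= H1.
- case/andP=> x1 H; have [||H1 H2] := IH Odd x.-1; rewrite /=; try by [|lia].
    by rewrite (_ : x.-1.*2.-1 = x.*2.-1.-2) //; lia.
  by rewrite tau_cons H2 /= H1 andbT; split=> //; lia.
Qed.

Lemma tau_bij (n : nat) : set_bij (walks n) (paths n) tau.
Proof.
split.
- move=> w /walks_walk_from[ww sw]; apply/paths_path_from.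
  split; first exact: path_from_tau ww.
  have [_ e1 e2 _] := (walk_fromP w (leqnn false)).1 ww.
  by rewrite num_North_tau; move: sw; rewrite size_num; lia.
- move=> u v; rewrite !inE => /walks_walk_from[uw _] /walks_walk_from[vw _] e.
  by rewrite -(tauK uw) e (tauK vw).
- move=> w /paths_path_from[wp wn].
  have [//|//|ww tw] := @untauP Even 0 w.
  exists (untau Even w) => //; apply/walks_walk_from; split=> //.
  have [_ e1 e2 _] := (walk_fromP (untau Even w) (leqnn false)).1 ww.
  by have := num_North_tau (untau Even w); rewrite tw wn size_num; lia.
Qed.

(** * Words in three letters *)

(* The three kinds of positions of a 12312-avoiding matching: an opener, a closer
   of the most recent open edge, a closer of the second most recent one. *)
Inductive letter := Open | Close | CloseSecond.

Definition is_open (l : letter) : bool := if l is Open then true else false.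

Definition is_close (l : letter) : bool := if l is Close then true else false.

(* [s] is the number of open edges and [f] tells whether the most recent opener
   still belongs to an open edge. *)
Fixpoint word_from (s : nat) (f : bool) (u : seq letter) : bool :=
  match u with
  | [::] => s == 0
  | Open :: u' => word_from s.+1 true u'
  | Close :: u' => (0 < s)%N && word_from s.-1 false u'
  | CloseSecond :: u' => [&& f, (1 < s)%N & word_from s.-1 true u']
  end.

Definition words (n : nat) : set (seq letter) :=
  [set u | word_from 0 false u /\ size u = (2 * n)%N].

(** Each letter is written as the steps joining the heights [2s - f] before and after it. *)
Fixpoint word_path (f : bool) (u : seq letter) : seq step :=
  match u with
  | [::] => [::]
  | Open :: u' => (if f then [:: East; East] else [:: East]) ++ word_path true u'
  | Close :: u' => (if f then [:: East; North] else [:: North]) ++ word_path false u'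
  | CloseSecond :: u' => North :: word_path true u'
  end.

(** With the flag set, [Open] and [Close] are written as with the flag cleared, after one more
    [East]; an [East] read in that state therefore only clears the flag. *)
Fixpoint path_word (f : bool) (w : seq step) : seq letter :=
  match w with
  | [::] => [::]
  | North :: w' =>
      if f then CloseSecond :: path_word true w' else Close :: path_word false w'
  | _ :: w' => if f then path_word false w' else Open :: path_word true w'
  end.

Lemma path_from_word_path (s : nat) (f : bool) (u : seq letter) : (f <= s)%N ->
  word_from s f u -> path_from (s.*2 - f) (word_path f u).
Proof.
elim: u s f => [|l u IH] s f fs /=; first by move/eqP->.
case: l => [/IH H|/andP[s0 /IH H]|/and3P[f0 s1 /IH H]].
- have {}H := H isT; case: f fs => fs /=.
    by have -> : (s.*2 - 1).+2 = (s.+1.*2 - 1)%N by lia.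
  by have -> : (s.*2 - 0).+1 = (s.+1.*2 - 1)%N by lia.
- have {}H := H isT; case: f fs => fs /=.
    have -> : (1 < (s.*2 - 1).+1)%N by lia.
    by have -> : (s.*2 - 1).-1 = (s.-1.*2 - 0)%N by lia.
  have -> : (1 < s.*2 - 0)%N by lia.
  by have -> : (s.*2 - 0).-2 = (s.-1.*2 - 0)%N by lia.
- rewrite /= f0; have -> : (1 < s.*2 - true)%N by lia.
  have -> : (s.*2 - true).-2 = (s.-1.*2 - 1)%N by lia.
  by apply: H; lia.
Qed.

Lemma word_pathK (s : nat) (f : bool) (u : seq letter) :
  word_from s f u -> path_word f (word_path f u) = u.
Proof.
elim: u s f => [|l u IH] s f //=.
by case: l => [/IH H|/andP[_ /IH H]|/and3P[-> _ /IH /= ->]//]; case: f => /=; rewrite H.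
Qed.

Lemma word_from_true (s : nat) (u : seq letter) :
  word_from s false u -> word_from s true u.
Proof. by case: u => // -[]. Qed.

Lemma word_path_true (s : nat) (u : seq letter) : (0 < s)%N ->
  word_from s false u -> word_path true u = East :: word_path false u.
Proof. by case: u => [|[] u] //=; case: s. Qed.

Lemma path_wordP (s : nat) (f : bool) (w : seq step) : (f <= s)%N ->
  path_from (s.*2 - f) w ->
  word_from s f (path_word f w) /\ word_path f (path_word f w) = w.
Proof.
elim: w s f => [|t w IH] s f fs /=.
  by move/eqP=> e; split=> //; case: f fs e => /=; lia.
case: t => // [|/andP[]]; case: f fs => fs.
- have -> : (s.*2 - true).+1 = (s.*2 - 0)%N by lia.
  case/(IH s false) => // H1 H2; rewrite (word_path_true _ H1) // H2; split=> //.
  exact: word_from_true.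
- have -> : (s.*2 - false).+1 = (s.+1.*2 - 1)%N by lia.
  by case/(IH s.+1 true) => // H1 H2; rewrite /= H1 H2.
- move=> s1; have -> : (s.*2 - true).-2 = (s.-1.*2 - 1)%N by lia.
  case/(IH s.-1 true) => [|H1 H2]; first by lia.
  by rewrite /= H1 H2 andbT; split=> //; lia.
- move=> s1; have -> : (s.*2 - false).-2 = (s.-1.*2 - 0)%N by lia.
  case/(IH s.-1 false) => // H1 H2.
  by rewrite /= H1 H2 andbT; split=> //; lia.
Qed.

(** Each closer contributes exactly one [North], and there are [s] more closers than openers. *)
Lemma size_word_from (s : nat) (f : bool) (u : seq letter) : word_from s f u ->
  (s + size u = 2 * num North (word_path f u))%N.
Proof.
elim: u s f => [|l u IH] s f /=; first by move/eqP->.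
case: l => [/IH H|/andP[s0 /IH H]|/and3P[f0 s1 /IH H]].
- by case: (f); rewrite /= !num_cons /=; lia.
- by case: (f); rewrite /= !num_cons /=; lia.
- by rewrite /= !num_cons /=; lia.
Qed.

Lemma word_path_bij (n : nat) : set_bij (words n) (paths n) (word_path false).
Proof.
split.
- move=> u [uw su]; apply/paths_path_from; split.
    exact: path_from_word_path uw.
  by have := size_word_from uw; lia.
- move=> u v; rewrite !inE => -[uw _] [vw _] e.
  by rewrite -(word_pathK uw) e (word_pathK vw).
- move=> w /paths_path_from[wp wn].
  have [//|//|uw e] := @path_wordP 0 false w.
  exists (path_word false w) => //; split=> //.
  by have := size_word_from uw; rewrite e wn.
Qed.

(** * From involutions to words *)

(** A matching is handled as the function exchanging the two ends of each edge. *)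
Definition fpf_involution (N : nat) (P : nat -> nat) : Prop :=
  forall i, (i < N)%N -> [/\ (P i < N)%N, P i != i & P (P i) = i].

(** Here [a] and [b] open two crossing edges and [c] plays the letter 3. Forbidding openers at [c]
    is enough: a closer in that role has its opener after [b]. *)
Definition avoids_12312 (N : nat) (P : nat -> nat) : Prop :=
  forall a b c, (a < b)%N -> (b < c)%N -> (c < P a)%N -> (P a < P b)%N ->
  (P b < N)%N -> (P c <= c)%N.

(* The openers of the edges open just before position [i], most recent first. *)
Definition open_stack (P : nat -> nat) (i : nat) : seq nat :=
  [seq a <- rev (iota 0 i) | (i <= P a)%N].

(** [CloseSecond] is given to every closer whose edge is not on top; only avoidance makes that edge
    the second one. *)
Definition letter_at (P : nat -> nat) (i : nat) : letter :=
  if (i < P i)%N then Open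
  else if head i (open_stack P i) == P i then Close else CloseSecond.

Definition matching_word (N : nat) (P : nat -> nat) : seq letter :=
  mkseq (letter_at P) N.

Definition popped (l : letter) (st : seq nat) : option nat :=
  match l, st with
  | Close, a :: _ => Some a
  | CloseSecond, _ :: a :: _ => Some a
  | _, _ => None
  end.

Definition next_stack (i : nat) (l : letter) (st : seq nat) : seq nat :=
  if l is Open then i :: st
  else if popped l st is Some a then rem a st else st.

Lemma mem_open_stack (P : nat -> nat) (i a : nat) :
  (a \in open_stack P i) = (a < i <= P a)%N.
Proof. by rewrite mem_filter mem_rev mem_iota add0n andbC. Qed.

Lemma open_stack_sorted (P : nat -> nat) (i : nat) : sorted gtn (open_stack P i).
Proof.
apply: sorted_filter; first by move=> y x z /=; lia.
by rewrite rev_sorted; apply: iota_ltn_sorted.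
Qed.

Lemma gtn_sorted_uniq (st : seq nat) : sorted gtn st -> uniq st.
Proof. by apply: sorted_uniq => [y x z|x] /=; lia. Qed.

Lemma gtn_sorted_cons (a : nat) (st : seq nat) :
  sorted gtn (a :: st) = all (gtn a) st && sorted gtn st.
Proof. by rewrite /= path_sortedE // => y x z /=; lia. Qed.

Lemma open_stackS (N : nat) (P : nat -> nat) (i : nat) :
  fpf_involution N P -> (i < N)%N ->
  open_stack P i.+1 =
  if (i < P i)%N then i :: open_stack P i else rem (P i) (open_stack P i).
Proof.
move=> invP iN; have [PN Pi PP] := invP i iN.
rewrite {1}/open_stack -addn1 iotaD rev_cat /= add0n addn1.
(* Passing from [i <= P a] to [i < P a] loses exactly the [a] with [P a = i], that is [a = P i]. *)
have e : [seq a <- rev (iota 0 i) | (i < P a)%N] =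
    [seq a <- open_stack P i | a != P i].
  rewrite /open_stack -filter_predI; apply: eq_in_filter => a.
  rewrite mem_rev mem_iota add0n => /andP[_ ai] /=.
  have [_ _ PPa] := invP a (ltn_trans ai iN).
  apply/idP/idP => [iP|/andP[aP iP]]; last first.
    rewrite ltn_neqAle iP andbT; apply: contra aP => /eqP ->.
    by rewrite PPa.
  rewrite (ltnW iP) andbT; apply/eqP => aP.
  by move: iP; rewrite aP PP ltnn.
rewrite e; case: ltnP => [iP|Pii].
  congr cons; apply/all_filterP/allP => a; rewrite mem_open_stack => /andP[ai _].
  by lia.
by rewrite rem_filter // gtn_sorted_uniq // open_stack_sorted.
Qed.

Lemma partner_in_open_stack (N : nat) (P : nat -> nat) (i : nat) :
  fpf_involution N P -> (i < N)%N -> (P i <= i)%N -> P i \in open_stack P i.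
Proof.
move=> invP iN Pi; have [PN Pn PP] := invP i iN.
by rewrite mem_open_stack PP leqnn andbT ltn_neqAle Pn.
Qed.

(** Avoidance confines the partner of a closer to the top two entries, so the letter tells which
    edge is closed. *)
Lemma popped_letter_at (N : nat) (P : nat -> nat) (i : nat) :
  fpf_involution N P -> avoids_12312 N P -> (i < N)%N -> (P i <= i)%N ->
  popped (letter_at P i) (open_stack P i) = Some (P i).
Proof.
move=> invP avP iN Pi; have [PN Pn PP] := invP i iN.
have := partner_in_open_stack invP iN Pi; have := open_stack_sorted P i.
rewrite /letter_at ltnNge Pi /=.
have memP a : a \in open_stack P i -> (a < i <= P a)%N by rewrite mem_open_stack.
move: memP; case: (open_stack P i) => [|x [|y r]] //= memP sst.
  by rewrite inE => /eqP ->; rewrite eqxx.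
case: eqP => [-> //|/eqP xP]; rewrite inE eq_sym (negbTE xP) /= inE.
case: eqP => [-> //|/eqP yP /= Pr].
(* The openers [P i < y < x] together with the closer [i] form a 12312. *)
have yx : (y < x)%N by case/andP: sst.
have Py : (P i < y)%N.
  have := sst : sorted gtn [:: x, y & r]; rewrite !gtn_sorted_cons.
  by case/and3P=> _ /allP/(_ _ Pr).
have /andP[xi ix] := memP x (mem_head _ _).
have /andP[yi iy] : (y < i <= P y)%N by apply: memP; rewrite !inE eqxx orbT.
have [PyN _ PPy] := invP y (ltn_trans yi iN).
have iPy : (i < P y)%N.
  rewrite ltn_neqAle iy andbT; apply/eqP => e.
  by move: yP; rewrite e PPy eqxx.
have := avP (P i) y x Py yx; rewrite PP => /(_ xi iPy PyN); lia.
Qed.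

Lemma open_stack_next (N : nat) (P : nat -> nat) (i : nat) :
  fpf_involution N P -> avoids_12312 N P -> (i < N)%N ->
  open_stack P i.+1 = next_stack i (letter_at P i) (open_stack P i).
Proof.
move=> invP avP iN; rewrite (open_stackS invP iN).
case: ltnP => [iP|Pi]; first by rewrite /letter_at iP.
rewrite /next_stack (popped_letter_at invP avP iN Pi).
by rewrite /letter_at ltnNge Pi /=; case: ifP.
Qed.

Lemma open_stack_end (N : nat) (P : nat -> nat) :
  fpf_involution N P -> open_stack P N = [::].
Proof.
move=> invP; apply/eqP; rewrite -[_ == _]negbK -has_filter; apply/hasPn => a.
by rewrite mem_rev mem_iota => /andP[_ /invP[]]; rewrite ltnNge.
Qed.

Lemma word_from_matching_word (N : nat) (P : nat -> nat) :
  fpf_involution N P -> avoids_12312 N P -> word_from 0 false (matching_word N P).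
Proof.
move=> invP avP.
(* Invariant: when the flag is cleared, each open edge [b] has an opener [c] after it. That opener
   would play the 3 if [CloseSecond] came next. *)
suff H k i f : (i + k = N)%N ->
    (f = false -> forall b, b \in open_stack P i ->
       exists c, [/\ (b < c)%N, (c < i)%N & (c < P c)%N]) ->
    word_from (size (open_stack P i)) f (map (letter_at P) (iota i k)).
  exact: (H N 0%N false).
elim: k i f => [|k IH] i f ikN Hf.
  by move: ikN; rewrite addn0 => -> /=; rewrite open_stack_end.
have iN : (i < N)%N by lia.
have ikN' : (i.+1 + k = N)%N by lia.
have [PN Pn PP] := invP i iN.
have := open_stack_next invP avP iN; have := IH i.+1 ^~ ikN'; rewrite [map _ (iota i k.+1)]/=.
have [iP|Pi] := ltnP i (P i).
  have -> : letter_at P i = Open by rewrite /letter_at iP.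
  by move=> + e; rewrite e => H /=; apply: (H true).
have := popped_letter_at invP avP iN Pi.
have memP a : a \in open_stack P i -> (a < i <= P a)%N by rewrite mem_open_stack.
have := open_stack_sorted P i.
have : letter_at P i <> Open by rewrite /letter_at ltnNge Pi /=; case: ifP.
case: (letter_at P i) => // _; case est: (open_stack P i) memP Hf => [|x st] //= memP Hf.
- move=> sst [xP]; rewrite /next_stack /= eqxx => {}IH e.
  (* The opener [x] of the edge just closed comes after every opener left on the stack. *)
  move: IH; rewrite e => /(_ false); apply=> _ b bst; exists x.
  have /andP[xi ix] := memP x (mem_head _ _).
  split; try by lia.
  by have := sst : sorted gtn (x :: st); rewrite gtn_sorted_cons => /andP[/allP/(_ _ bst)].
- case: st est memP Hf => [|y r] // est memP Hf sst [yP] {}IH e.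
  have yx : (y < x)%N by case/andP: sst.
  have xy : (x == y) = false by apply/eqP; lia.
  move: IH; rewrite e /next_stack /= xy eqxx /= => /(_ true) -> //; rewrite !andbT.
  (* The edges opened at [y] and [x] cross, with closers [i] and [P x], and [c] opens between [x]
     and [i]. *)
  case: f Hf => // Hf; exfalso.
  have [c [xc ci cP]] := Hf erefl x (mem_head _ _).
  have /andP[xi ix] := memP x (mem_head _ _).
  have [PxN _ PPx] := invP x (ltn_trans xi iN).
  have iPx : (i < P x)%N.
    rewrite ltn_neqAle ix andbT; apply/eqP => ei.
    by move: xy; rewrite yP ei PPx eqxx.
  have := avP y x c yx xc; rewrite yP PP => /(_ ci iPx PxN); lia.
Qed.

(** The word determines the stacks step by step, hence the partner of every closer, and by
    involutivity that of every opener. *)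
Lemma matching_word_inj (N : nat) (P Q : nat -> nat) :
  fpf_involution N P -> avoids_12312 N P ->
  fpf_involution N Q -> avoids_12312 N Q ->
  matching_word N P = matching_word N Q -> forall i, (i < N)%N -> P i = Q i.
Proof.
move=> invP avP invQ avQ e.
have el i : (i < N)%N -> letter_at P i = letter_at Q i.
  by move=> iN; rewrite -(nth_mkseq Open _ iN) -[RHS](nth_mkseq Open _ iN) -/(matching_word _ _) e.
have es i : (i <= N)%N -> open_stack P i = open_stack Q i.
  elim: i => // i IH iN.
  by rewrite (open_stack_next invP avP iN) (open_stack_next invQ avQ iN) el // IH // ltnW.
have open_letter R i : (i < R i)%N = is_open (letter_at R i).
  by rewrite /letter_at; case: ifP => //; case: ifP.
have eclose i : (i < N)%N -> (P i <= i)%N -> P i = Q i.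
  move=> iN Pi; have Qi : (Q i <= i)%N by rewrite leqNgt open_letter -el // -open_letter -leqNgt.
  have := popped_letter_at invP avP iN Pi; rewrite el // es ?(ltnW iN) //.
  by rewrite (popped_letter_at invQ avQ iN Qi) => -[].
move=> i iN; have [iP|] := ltnP i (P i); last exact: eclose.
have [PN Pn PP] := invP i iN.
have := eclose (P i) PN; rewrite PP => /(_ (ltnW iP)) {2}->.
by have [] := invQ (P i) PN.
Qed.

(** * From words to involutions *)

(** The stack rebuilt from the word alone; the default letter is not reached while [i <= size u]. *)
Fixpoint stack_at (u : seq letter) (i : nat) : seq nat :=
  if i is i'.+1 then next_stack i' (nth Open u i') (stack_at u i') else [::].

Definition flag_at (u : seq letter) (i : nat) : bool :=
  if i is i'.+1 then ~~ is_close (nth Open u i') else false.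

Definition popped_at (u : seq letter) (i : nat) : option nat :=
  popped (nth Open u i) (stack_at u i).

Lemma mem_popped (l : letter) (st : seq nat) (a : nat) :
  popped l st = Some a -> a \in st.
Proof.
by case: l => //; case: st => [|x [|y r]] //= [->]; rewrite !inE eqxx ?orbT.
Qed.

Lemma word_from_stack_at (u : seq letter) (i : nat) :
  word_from 0 false u -> (i <= size u)%N ->
  word_from (size (stack_at u i)) (flag_at u i) (drop i u).
Proof.
move=> uw; elim: i => [|i IH] iu; first by rewrite drop0.
have {IH} := IH (ltnW iu); rewrite (drop_nth Open iu) /= /next_stack.
case: (nth Open u i) => //=; case: (stack_at u i) => [|x [|y r]] //=;
  rewrite ?eqxx ?andbF //; case/andP=> _ //.
by case: eqP.
Qed.

Lemma popped_atP (u : seq letter) (i : nat) :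
  word_from 0 false u -> (i < size u)%N ->
  [\/ nth Open u i = Open,
      nth Open u i = Close /\ exists a r, stack_at u i = a :: r
    | [/\ nth Open u i = CloseSecond, flag_at u i
        & exists b a r, stack_at u i = [:: b, a & r]]].
Proof.
move=> uw iu; have := word_from_stack_at uw (ltnW iu).
rewrite (drop_nth Open iu) /=; case: (nth Open u i) => [_|/andP[+ _]|/and3P[-> + _]].
- by constructor 1.
- by case: (stack_at u i) => [|a r] // _; constructor 2; split=> //; exists a, r.
- case: (stack_at u i) => [|b [|a r]] // _; constructor 3; split=> //.
  by exists b, a, r.
Qed.

Lemma popped_at_close (u : seq letter) (i : nat) :
  word_from 0 false u -> (i < size u)%N -> ~~ is_open (nth Open u i) ->
  exists a, popped_at u i = Some a.
Proof.
move=> uw iu; rewrite /popped_at.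
have [->//|[-> [a [r ->]]]|[-> _ [b [a [r ->]]]]] := popped_atP uw iu => _ /=.
  by exists a.
by exists a.
Qed.

Lemma stack_atP (u : seq letter) (i : nat) :
  sorted gtn (stack_at u i) /\
  forall a, a \in stack_at u i -> (a < i)%N /\ nth Open u a = Open.
Proof.
elim: i => [|i [IH1 IH2]] //=; rewrite /next_stack.
have IH3 a : a \in stack_at u i -> (a < i.+1)%N /\ nth Open u a = Open.
  by case/IH2 => ai ->; rewrite ltnS ltnW.
have closed l : sorted gtn (if popped l (stack_at u i) is Some a
      then rem a (stack_at u i) else stack_at u i) /\
    forall a, a \in (if popped l (stack_at u i) is Some a
      then rem a (stack_at u i) else stack_at u i) ->
    (a < i.+1)%N /\ nth Open u a = Open.
  case: popped => [a|]; last by split.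
  split; last by move=> b /mem_rem /IH3.
  by apply: subseq_sorted (rem_subseq _ _) IH1 => y x z /=; lia.
case el: (nth Open u i); try exact: closed.
split.
  rewrite gtn_sorted_cons IH1 andbT; apply/allP => a /IH2[] //.
by move=> a; rewrite inE => /predU1P[->|/IH3 //]; rewrite el.
Qed.

Lemma stack_at_uniq (u : seq letter) (i : nat) : uniq (stack_at u i).
Proof. by apply: gtn_sorted_uniq; have [] := stack_atP u i. Qed.

Lemma popped_at_lt (u : seq letter) (i a : nat) :
  popped_at u i = Some a -> (a < i)%N /\ nth Open u a = Open.
Proof. by move/mem_popped; have [_] := stack_atP u i; apply. Qed.

Lemma stack_atS_popped (u : seq letter) (i a : nat) :
  popped_at u i = Some a -> stack_at u i.+1 = rem a (stack_at u i).
Proof.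
by rewrite /popped_at /= /next_stack; case: (nth Open u i) => //= ->.
Qed.

Lemma stack_at_end (u : seq letter) :
  word_from 0 false u -> stack_at u (size u) = [::].
Proof.
move=> uw; have := word_from_stack_at uw (leqnn _).
by rewrite drop_size /= => /nilP.
Qed.

(** The stack is empty at the end of the word, and an entry leaves it only by being popped. *)
Lemma popped_eventually (u : seq letter) (i a : nat) :
  word_from 0 false u -> (i <= size u)%N -> a \in stack_at u i ->
  exists j, [/\ (i <= j)%N, (j < size u)%N & popped_at u j = Some a].
Proof.
move=> uw iu; move ek : (size u - i)%N => k.
elim: k i iu ek => [|k IH] i iu ek ai.
  have ei : i = size u by lia.
  by move: ai; rewrite ei stack_at_end.
have {}iu : (i < size u)%N by lia.
have [e|ne] := eqVneq (popped_at u i) (Some a); first by exists i.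
have /IH[||j [ij ju pj]] : a \in stack_at u i.+1.
- move: ne; rewrite /= /next_stack /popped_at.
  case: (nth Open u i); first by rewrite inE ai orbT.
    by case: popped => // b ne; rewrite mem_rem_uniq ?stack_at_uniq // inE ai andbT;
       apply: contra ne => /eqP ->.
  by case: popped => // b ne; rewrite mem_rem_uniq ?stack_at_uniq // inE ai andbT;
     apply: contra ne => /eqP ->.
- by [].
- by lia.
by exists j; split=> //; lia.
Qed.

(** A step pushes only its own position, so an earlier position never returns. *)
Lemma stack_at_dead (u : seq letter) (i j a : nat) :
  (a < i)%N -> (i <= j)%N -> a \notin stack_at u i -> a \notin stack_at u j.
Proof.
move=> ai ij; have -> : j = (i + (j - i))%N by lia.
elim: (j - i)%N => [|k IH]; first by rewrite addn0.
move/IH; apply: contra; rewrite addnS /= /next_stack.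
case: (nth Open u _); first by rewrite inE => /predU1P[e|//]; lia.
  by case: popped => // b /mem_rem.
by case: popped => // b /mem_rem.
Qed.

Lemma popped_at_inj (u : seq letter) (i j a : nat) :
  popped_at u i = Some a -> popped_at u j = Some a -> i = j.
Proof.
wlog ij : i j / (i < j)%N.
  move=> H pi pj; have [ij|ji|//] := ltngtP i j; first exact: H.
  by apply/esym/H.
move=> pi /mem_popped aj; have [ai _] := popped_at_lt pi.
suff : a \notin stack_at u j by rewrite aj.
apply: (@stack_at_dead u i.+1) => //; first by lia.
by rewrite (stack_atS_popped pi) mem_rem_uniqF ?stack_at_uniq.
Qed.

(** An opener searches for the position that pops it. For accepted words the fallback values of
    [find] and [odflt] do not occur at positions below [size u]. *)
Definition partner_of (u : seq letter) (i : nat) : nat :=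
  if is_open (nth Open u i) then
    find (fun j => popped_at u j == Some i) (iota 0 (size u))
  else odflt i (popped_at u i).

Lemma partner_of_popped (u : seq letter) (i a : nat) : (i < size u)%N ->
  popped_at u i = Some a -> partner_of u i = a /\ partner_of u a = i.
Proof.
move=> iu pi; have [ai oa] := popped_at_lt pi.
rewrite /partner_of oa pi /=; split.
  by move: pi; rewrite /popped_at; case: (nth Open u i).
set p := (fun j => _); have hp : has p (iota 0 (size u)).
  by apply/hasP; exists i; rewrite ?mem_iota // /p pi.
have := nth_find 0%N hp; rewrite nth_iota; last by move: hp; rewrite has_find size_iota.
rewrite add0n /p => /eqP pj; exact: popped_at_inj pj pi.
Qed.

Lemma popped_of_open (u : seq letter) (i : nat) :
  word_from 0 false u -> (i < size u)%N -> nth Open u i = Open ->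
  exists j, [/\ (i < j)%N, (j < size u)%N & popped_at u j = Some i].
Proof.
move=> uw iu oi; apply: popped_eventually => //.
by rewrite /= /next_stack oi inE eqxx.
Qed.

Lemma is_openP (l : letter) : reflect (l = Open) (is_open l).
Proof. by case: l; constructor. Qed.

Lemma partner_of_fpf (u : seq letter) :
  word_from 0 false u -> fpf_involution (size u) (partner_of u).
Proof.
move=> uw i iu; case: (is_openP (nth Open u i)) => [oi|/is_openP ci].
  have [j [ij ju pj]] := popped_of_open uw iu oi.
  by have [e1 e2] := partner_of_popped ju pj; rewrite e2 e1; split=> //; lia.
have [a pa] := popped_at_close uw iu ci.
have [ai _] := popped_at_lt pa.
by have [-> ->] := partner_of_popped iu pa; split=> //; lia.
Qed.

Lemma partner_of_lt (u : seq letter) (i : nat) :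
  word_from 0 false u -> (i < size u)%N ->
  (i < partner_of u i)%N = is_open (nth Open u i).
Proof.
move=> uw iu; case: (is_openP (nth Open u i)) => [oi|/is_openP ci].
  have [j [ij ju pj]] := popped_of_open uw iu oi.
  by have [_ ->] := partner_of_popped ju pj.
have [a pa] := popped_at_close uw iu ci.
have [ai _] := popped_at_lt pa.
by have [-> _] := partner_of_popped iu pa; lia.
Qed.

Lemma open_stack_partner_of (u : seq letter) (i : nat) :
  word_from 0 false u -> (i <= size u)%N ->
  open_stack (partner_of u) i = stack_at u i.
Proof.
move=> uw; elim: i => // i IH iu.
rewrite (open_stackS (partner_of_fpf uw) iu) IH ?(ltnW iu) // partner_of_lt //.
case: is_openP => [oi|/is_openP ci]; first by rewrite /= /next_stack oi.
have [a pa] := popped_at_close uw iu ci.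
by have [-> _] := partner_of_popped iu pa; rewrite (stack_atS_popped pa).
Qed.

Lemma matching_word_partner_of (u : seq letter) :
  word_from 0 false u -> matching_word (size u) (partner_of u) = u.
Proof.
move=> uw; apply: (@eq_from_nth _ Open); first by rewrite size_mkseq.
move=> i; rewrite size_mkseq => iu; rewrite nth_mkseq //.
rewrite /letter_at partner_of_lt // open_stack_partner_of // ?(ltnW iu) //.
have [->//|[el [a [r es]]]|[el _ [b [a [r es]]]]] := popped_atP uw iu.
  have pa : popped_at u i = Some a by rewrite /popped_at el es.
  by have [-> _] := partner_of_popped iu pa; rewrite el es /= eqxx.
have pa : popped_at u i = Some a by rewrite /popped_at el es.
have [-> _] := partner_of_popped iu pa; rewrite el es /=.
(* The entries are distinct, so the second one is not mistaken for the top. *)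
have := stack_at_uniq u i; rewrite es /= inE negb_or => /andP[/andP[ba _] _].
by rewrite (negbTE ba).
Qed.

(** A set flag means that the top is the last opener read: [Open] puts it there, and [CloseSecond]
    removes the entry below it without opening anything. *)
Lemma flag_atP (u : seq letter) (i : nat) :
  word_from 0 false u -> (i <= size u)%N -> flag_at u i ->
  forall x st j, stack_at u i = x :: st -> (x < j)%N -> (j < i)%N ->
  nth Open u j <> Open.
Proof.
move=> uw; elim: i => // i IH iu /= + x st j.
have := popped_atP uw iu; rewrite /next_stack.
move=> [->|[->] //|[el fi [b [a [r es]]]]] /= _.
  by case=> -> _; lia.
rewrite es el /= => e xj; rewrite ltnS leq_eqVlt => /predU1P[->|ji].
  by rewrite el.
apply: (IH (ltnW iu) fi b (a :: r)) => //.
have := stack_at_uniq u i; rewrite es /= inE negb_or => /andP[/andP[ba _] _].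
by move: e; rewrite (negbTE ba) => -[->].
Qed.

(** At the closer [i] of [a] the later edge [b] is still open. The letter is thus [CloseSecond],
    with [b] on top and the flag set, and [flag_atP] excludes an opener between [b] and [i]. *)
Lemma partner_of_avoids (u : seq letter) :
  word_from 0 false u -> avoids_12312 (size u) (partner_of u).
Proof.
move=> uw a b c ab bc cPa Pab PbN; rewrite leqNgt; apply/negP => cPc.
have invP := partner_of_fpf uw.
have iu : (partner_of u a < size u)%N by lia.
have [_ _ PPa] := invP a ltac:(lia).
have := cPc; rewrite partner_of_lt ?(ltn_trans cPa) // => /is_openP oc.
set i := partner_of u a in cPa Pab iu PPa.
have mem d : (d < i <= partner_of u d)%N -> d \in stack_at u i.
  by rewrite -open_stack_partner_of ?(ltnW iu) // mem_open_stack.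
have [sst _] := stack_atP u i.
have bst : b \in stack_at u i by apply: mem; lia.
have := partner_of_lt uw iu; rewrite PPa.
have [->/=|[el [x [r es]]]|[el fi [x [y [r es]]]]] := popped_atP uw iu; first by lia.
  have pi : popped_at u i = Some x by rewrite /popped_at el es.
  have [e _] := partner_of_popped iu pi.
  have := gtn_sorted_cons x r; rewrite -es sst => /esym/andP[/allP H _] _.
  move: bst; rewrite es inE => /predU1P[|/H /=]; rewrite -e PPa; lia.
have pi : popped_at u i = Some y by rewrite /popped_at el es.
have [e _] := partner_of_popped iu pi => _.
have bx : b = x.
  move: sst bst; rewrite es !gtn_sorted_cons !inE => /and3P[_ /allP H _].
  by case/or3P=> [/eqP //|/eqP|/H /=]; rewrite -e PPa; lia.
apply: (flag_atP uw (ltnW iu) fi es _ cPa oc); lia.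
Qed.

(** * Matchings *)

(** Extended by the identity outside ['I_N] to give a function on [nat]. *)
Definition mate (N : nat) (m : {set {set 'I_N}}) (i : nat) : nat :=
  if insub i is Some x then
    if [pick y in (finset.pblock m x :\ x)%SET] is Some y then val y else i
  else i.

Lemma mem_matching_pblock (N : nat) (m : {set {set 'I_N}}) (x : 'I_N) :
  is_matching m -> finset.pblock m x \in m /\ x \in finset.pblock m x.
Proof.
case=> /and3P[/eqP cov _ _] _.
have xc : x \in finset.cover m by rewrite cov finset.in_setT.
by rewrite finset.pblock_mem // finset.mem_pblock.
Qed.

Lemma mate_spec (N : nat) (m : {set {set 'I_N}}) (x : 'I_N) :
  is_matching m ->
  exists y : 'I_N, [/\ mate m x = y, y != x & finset.pblock m x = [set x; y]%SET].
Proof.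
move=> mm; have [bm xb] := mem_matching_pblock x mm.
have := mm.2 _ bm; rewrite (finset.cardsD1 x) xb => -[] /eqP/finset.cards1P[y ey].
have yx : y != x.
  have : y \in (finset.pblock m x :\ x)%SET by rewrite ey finset.set11.
  by rewrite finset.in_setD1 => /andP[].
exists y; split=> //; last by rewrite -(finset.setD1K xb) ey.
rewrite /mate valK; case: pickP => [z|/(_ y)]; rewrite ey finset.in_set1 ?eqxx //.
by move/eqP->.
Qed.

Lemma mem_pblock_mate (N : nat) (m : {set {set 'I_N}}) (x y : 'I_N) :
  is_matching m ->
  (y \in finset.pblock m x) = (y == x) || (val y == mate m x).
Proof. by case/(mate_spec x)=> z [-> _ ->]; rewrite finset.in_set2. Qed.

Lemma mate_fpf (N : nat) (m : {set {set 'I_N}}) :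
  is_matching m -> fpf_involution N (mate m).
Proof.
move=> mm i iN; have [y [e yx eb]] := mate_spec (Ordinal iN) mm.
have [bm xb] := mem_matching_pblock (Ordinal iN) mm.
rewrite /= in e; rewrite e; split=> //.
have yb : y \in finset.pblock m (Ordinal iN) by rewrite eb finset.set22.
have := mem_pblock_mate y (Ordinal iN) mm.
have [/and3P[_ tr _] _] := mm.
rewrite (finset.def_pblock tr bm yb) xb eq_sym (negbTE yx) /=.
by move/esym/eqP.
Qed.

(** * Edge minima and labels *)

Lemma edge_min_geP (N k : nat) (b : {set 'I_N}) :
  reflect ((k <= N)%N /\ forall i, i \in b -> (k <= i)%N) (k <= edge_min b)%N.
Proof.
rewrite /edge_min; apply: (iffP idP).
- move=> H; split.
    (* The big minimum starts from its default [N], whence this bound. *)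
    apply: leq_trans H _; elim/big_rec: _ => // i x _ xN.
    by rewrite geq_min xN orbT.
  move=> i ib; apply: leq_trans H _.
  have := mem_index_enum i; elim: (index_enum _) => // j r IH.
  rewrite inE big_cons => /predU1P[<-|ir]; first by rewrite ib geq_minl.
  by case: ifP => _; rewrite ?geq_min IH ?orbT.
- by case=> kN H; elim/big_ind: _ => // x y kx ky; rewrite leq_min kx.
Qed.

Lemma edge_min_pblock (N : nat) (m : {set {set 'I_N}}) (x : 'I_N) :
  is_matching m -> edge_min (finset.pblock m x) = minn x (mate m x).
Proof.
move=> mm; have [y [e yx eb]] := mate_spec x mm.
rewrite e eb; apply/eqP; rewrite eqn_leq; apply/andP; split.
  have /edge_min_geP[_ H] := leqnn (edge_min [set x; y]%SET).
  by rewrite leq_min !H // ?finset.set21 ?finset.set22.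
apply/edge_min_geP; split; first by have := ltn_ord x; lia.
by move=> i; rewrite finset.in_set2 => /orP[]/eqP->; lia.
Qed.

(** The sets of edges counted by two labels are nested; when [c] has the larger minimum, it lies in
    its own set but not in that of [b]. *)
Lemma edge_label_lt (N : nat) (m : {set {set 'I_N}}) (b c : {set 'I_N}) :
  c \in m ->
  (edge_label m b < edge_label m c)%N = (edge_min b < edge_min c)%N.
Proof.
move=> cm; rewrite /edge_label; case: (ltnP (edge_min b)) => [bc|cb].
  apply/proper_card/fintype.properP; split.
    apply/fintype.subsetP => d; rewrite !finset.inE => /andP[-> /= db].
    exact: leq_trans db (ltnW bc).
  by exists c; rewrite !finset.inE cm //= -ltnNge.
apply/negbTE; rewrite -leqNgt; apply/subset_leq_card/fintype.subsetP => d.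
rewrite !finset.inE => /andP[-> /= dc]; exact: leq_trans dc cb.
Qed.

Lemma block_label_lt (N : nat) (m : {set {set 'I_N}}) (x y : 'I_N) :
  is_matching m ->
  (edge_label m (finset.pblock m x) < edge_label m (finset.pblock m y))%N =
  (minn x (mate m x) < minn y (mate m y))%N.
Proof.
move=> mm; have [ym _] := mem_matching_pblock y mm.
by rewrite edge_label_lt // !edge_min_pblock.
Qed.

(** The smaller end identifies an edge; this turns equal letters of a canonical form back into an
    edge. *)
Lemma fpf_involution_min_eq (N : nat) (P : nat -> nat) (i j : nat) :
  fpf_involution N P -> (i < j)%N -> (j < N)%N ->
  minn i (P i) = minn j (P j) -> P i = j.
Proof.
move=> invP ij jN e; have [_ _ PPj] := invP j jN.
have [_ _ PPi] := invP i (ltn_trans ij jN).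
have [e1|e1] : minn i (P i) = i \/ minn i (P i) = P i by lia.
  by rewrite -PPj; congr P; lia.
have [e2|e2] : minn j (P j) = j \/ minn j (P j) = P j by lia.
  by lia.
have : P (P i) = P (P j) by congr P; lia.
by rewrite PPi PPj; lia.
Qed.

(** The list is the enumeration filtered by membership in it: both are strictly sorted with the same
    elements. *)
Lemma sorted_ord_subseq_enum (N : nat) (t : seq 'I_N) :
  sorted (fun x y : 'I_N => (x < y)%N) t -> subseq t (enum 'I_N).
Proof.
move=> st; have -> : t = [seq x <- enum 'I_N | x \in t].
  apply: (@irr_sorted_eq _ (fun x y : 'I_N => (x < y)%N)) => //.
  - by move=> y x z /=; lia.
  - by move=> x /=; lia.
  - apply: sorted_filter; first by move=> y x z /=; lia.
    by have := iota_ltn_sorted 0 N; rewrite -val_enum_ord sorted_map.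
  - by move=> x; rewrite mem_filter mem_enum andbT.
exact: filter_subseq.
Qed.

Lemma containsP (N : nat) (m : {set {set 'I_N}}) :
  is_matching m -> contains m [:: 1; 2; 3; 1; 2]%N <-> ~ avoids_12312 N (mate m).
Proof.
move=> mm; have invP := mate_fpf mm.
split.
(* The subsequence of labels is pulled back to an increasing list of positions. *)
- case=> s /subseqP[k _]; rewrite -map_mask.
  set t := mask k _ => es [sz iso] avP.
  have st : sorted (fun x y : 'I_N => (x < y)%N) t.
    apply: (@subseq_sorted _ _ _ _ (enum 'I_N)); [|exact: mask_subseq|].
      by move=> y x z /=; lia.
    by have := iota_ltn_sorted 0 N; rewrite -val_enum_ord sorted_map.
  move: sz iso; rewrite es size_map /=.
  case: t st {es} => [|x1 [|x2 [|x3 [|x4 [|x5 []]]]]] //= st _ iso.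
  (* Since [order_iso] only speaks of [<], each equality of the pattern is read off from two failed
     inequalities. *)
  have := iso 0%N 1%N isT isT; have := iso 1%N 2%N isT isT.
  have := iso 0%N 3%N isT isT; have := iso 3%N 0%N isT isT.
  have := iso 1%N 4%N isT isT; have := iso 4%N 1%N isT isT.
  rewrite /= !block_label_lt // => h41 h14 h30 h03 h12 h01.
  have {}h01 : (minn x1 (mate m x1) < minn x2 (mate m x2))%N by apply/h01.
  have {}h12 : (minn x2 (mate m x2) < minn x3 (mate m x3))%N by apply/h12.
  have {}h03 : ~ (minn x1 (mate m x1) < minn x4 (mate m x4))%N by move/h03.
  have {}h30 : ~ (minn x4 (mate m x4) < minn x1 (mate m x1))%N by move/h30.
  have {}h14 : ~ (minn x2 (mate m x2) < minn x5 (mate m x5))%N by move/h14.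
  have {}h41 : ~ (minn x5 (mate m x5) < minn x2 (mate m x2))%N by move/h41.
  case/and5P: st => l12 l23 l34 l45 _.
  have e14 : mate m x1 = x4.
    by apply: (fpf_involution_min_eq invP) => //; lia.
  have e25 : mate m x2 = x5.
    by apply: (fpf_involution_min_eq invP) => //; lia.
  have [P3N n3 PP3] := invP x3 (ltn_ord x3).
  have [e3|e3] : minn x3 (mate m x3) = x3 \/ minn x3 (mate m x3) = mate m x3 by lia.
    have := avP x1 x2 x3 l12 l23; rewrite e14 e25 => /(_ l34 l45 (ltn_ord _)).
    by lia.
  (* When the 3 sits on a closer, its opener lies between [x2] and [x3] and takes its place. *)
  have := avP x1 x2 (mate m x3) l12; rewrite e14 e25 PP3.
  by move=> /(_ ltac:(lia) ltac:(lia) l45 (ltn_ord _)); lia.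
- move=> navP; apply: contrapT => ncm; apply: navP => a b c ab bc ca Pab PbN.
  rewrite leqNgt; apply/negP => cP; apply: ncm.
  have aN : (a < N)%N by lia.
  have bN : (b < N)%N by lia.
  have cN : (c < N)%N by lia.
  have PaN : (mate m a < N)%N by lia.
  have [_ _ PPa] := invP a aN; have [_ _ PPb] := invP b bN.
  pose t := [:: Ordinal aN; Ordinal bN; Ordinal cN; Ordinal PaN; Ordinal PbN].
  exists [seq edge_label m (finset.pblock m i) | i <- t].
    apply: map_subseq; apply: sorted_ord_subseq_enum => /=.
    by rewrite ab bc ca Pab.
  split=> // i j; rewrite size_map.
  by case: i => [|[|[|[|[|i]]]]] //; case: j => [|[|[|[|[|j]]]]] //= _ _;
     rewrite block_label_lt //= ?PPa ?PPb; lia.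
Qed.

(** * From involutions back to matchings *)

Lemma avoids_12312_ext (N : nat) (P Q : nat -> nat) :
  (forall i, (i < N)%N -> P i = Q i) -> avoids_12312 N P -> avoids_12312 N Q.
Proof.
move=> e avP a b c ab bc ca Pab PbN.
have [ea eb ec] : [/\ P a = Q a, P b = Q b & P c = Q c] by split; apply: e; lia.
by have := avP a b c ab bc; rewrite ea eb ec; apply.
Qed.

Lemma matching_word_ext (N : nat) (P Q : nat -> nat) :
  (forall i, (i < N)%N -> P i = Q i) -> matching_word N P = matching_word N Q.
Proof.
move=> e; apply: (@eq_from_nth _ Open); rewrite !size_mkseq // => i iN.
rewrite !nth_mkseq // /letter_at e //.
suff -> : open_stack P i = open_stack Q i by [].
apply: eq_in_filter => a; rewrite mem_rev mem_iota => /andP[_ ai].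
by rewrite e //; lia.
Qed.

Lemma fpf_involution_min_eqE (N : nat) (P : nat -> nat) (i j : nat) :
  fpf_involution N P -> (i < N)%N -> (j < N)%N ->
  (minn i (P i) == minn j (P j)) = (j == i) || (j == P i).
Proof.
move=> invP iN jN; have [_ _ PPi] := invP i iN; have [_ _ PPj] := invP j jN.
apply/eqP/idP => [e|/orP[]/eqP-> //]; last by rewrite PPi minnC.
have [ij|ji|//] := ltngtP j i.
  by rewrite -(fpf_involution_min_eq invP ij iN (esym e)) PPj eqxx.
by rewrite (fpf_involution_min_eq invP ji jN e) eqxx.
Qed.

(** The blocks are the fibres of [x |-> minn x (P x)], which are the pairs formed by [x] and
    [P x]. *)
Lemma matching_of_involution (N : nat) (P : nat -> nat) : fpf_involution N P ->
  exists2 m : {set {set 'I_N}}, is_matching m &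
    forall i, (i < N)%N -> mate m i = P i.
Proof.
move=> invP; pose f (x : 'I_N) := minn x (P x).
pose m := finset.preim_partition f [set: 'I_N]%SET.
have mm : is_matching m.
  split; first exact: finset.preim_partitionP.
  move=> _ /finset.imsetP[x _ ->]; have [PN Px PPx] := invP x (ltn_ord x).
  rewrite (_ : [set _ in _ | _]%SET = [set x; Ordinal PN]%SET).
    by rewrite finset.cards2 -val_eqE /= eq_sym Px.
  apply/finset.setP => y; rewrite !finset.inE /= /f -!val_eqE /=.
  exact: (fpf_involution_min_eqE invP).
exists m => // i iN; have [PN Px PPx] := invP i iN.
have := mem_pblock_mate (Ordinal iN) (Ordinal PN) mm.
rewrite finset.pblock_equivalence_partition ?finset.in_setT //; last first.
  by move=> x y z _ _ _; split=> // /eqP ->.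
rewrite /f /= (fpf_involution_min_eqE invP iN PN) eqxx orbT -val_eqE /= (negbTE Px).
by move/esym/eqP.
Qed.

Lemma matching_word_bij (n : nat) :
  set_bij (avoiding_matchings n [:: 1; 2; 3; 1; 2]%N) (words n)
    (fun m => matching_word (2 * n) (mate m)).
Proof.
have av m : avoiding_matchings n [:: 1; 2; 3; 1; 2]%N m ->
    [/\ is_matching m, fpf_involution (2 * n) (mate m)
      & avoids_12312 (2 * n) (mate m)].
  case=> mm /(containsP mm) nav; split=> //; first exact: mate_fpf.
  exact: contrapT.
split.
- move=> m /av[mm invP avP]; split; first exact: word_from_matching_word.
  by rewrite size_mkseq.
- move=> m1 m2; rewrite !inE => /av[mm1 inv1 av1] /av[mm2 inv2 av2] e.
  have {}e := matching_word_inj inv1 av1 inv2 av2 e.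
  (* A partition is recovered from its function [pblock], which the mates determine. *)
  rewrite -(finset.preim_partition_pblock mm1.1) -(finset.preim_partition_pblock mm2.1).
  congr (finset.preim_partition _ _); apply/funext => x.
  by apply/finset.setP => y; rewrite !mem_pblock_mate // e.
- move=> u [uw su].
  have [m mm em] := matching_of_involution (partner_of_fpf uw).
  rewrite su in m mm em *; exists m.
    split=> //; apply/(containsP mm); apply.
    apply: (@avoids_12312_ext _ (partner_of u)); first by move=> i /em.
    by rewrite -su; apply: partner_of_avoids.
  by rewrite (matching_word_ext em) -su matching_word_partner_of.
Qed.

Theorem theorem5 (n : nat) (hn : (1 <= n)%N) :
  set_bij (walks n) (paths n) tau /\
  exists k : nat,
    [/\ (walks n #= `I_k)%card,
        (paths n #= `I_k)%card,
        (avoiding_matchings n [:: 1; 2; 3; 1; 2]%N #= `I_k)%card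
      & k%:R = ((2 * n + 1)%N%:R)^-1 * 'C(3 * n, n)%:R :> rat].
Proof.
split; first exact: tau_bij.
have pathsI : (paths n #= `I_(size (ballot_words (3 * n) n)))%card.
  by rewrite paths_ballot_words; apply/card_eq_seq/uniq_ballot_words.
exists (size (ballot_words (3 * n) n)); split=> //.
- exact: card_eq_trans (set_bij_card_eq (tau_bij n)) pathsI.
- apply: card_eq_trans (set_bij_card_eq (matching_word_bij n)) _.
  exact: card_eq_trans (set_bij_card_eq (word_path_bij n)) pathsI.
- rewrite -size_ballot_words_fuss_catalan natrM mulKf //.
  by rewrite pnatr_eq0 addn1.
Qed.
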